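(* Let $H_1$ and $H_2$ be real Hilbert spaces, and let $\Omega_1\subset H_1$ and $\Omega_2\subset H_2$ be nonempty compact convex sets. Let $A\colon H_2\to H_1$ and $B\colon H_1\to H_2$ be continuous linear operators, and define the payoff functions $u_1,u_2\colon \Omega_1\times\Omega_2\to\mathbb{R}$ by $$u_1(p,q):=\langle p,Aq\rangle\quad\text{and}\quad u_2(p,q):=\langle q,Bp\rangle .$$ Then the two-person game $\{\Omega_i,u_i\}$, $i=1,2$, admits a Nash equilibrium.
   Context: All vector spaces are over $\mathbb{R}$. Here $\langle\cdot,\cdot\rangle$ denotes the inner product of the respective Hilbert space. A two-person game $\{\Omega_i,u_i\}$, $i=1,2$, consists of nonempty strategy sets $\Omega_1,\Omega_2$ and payoff functions $u_1,u_2\colon\Omega_1\times\Omega_2\to\mathbb{R}$. A Nash equilibrium of the game is a pair $(\bar p,\bar q)\in\Omega_1\times\Omega_2$ such that $u_1(p,\bar q)\le u_1(\bar p,\bar q)$ for all $p\in\Omega_1$ and $u_2(\bar p,q)\le u_2(\bar p,\bar q)$ for all $q\in\Omega_2$. *)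

(* Defs.v *)
From HB Require Import structures.
From mathcomp Require Import all_boot all_order all_algebra.
From mathcomp Require Import all_classical all_reals all_analysis.

Set Implicit Arguments.
Unset Strict Implicit.
Unset Printing Implicit Defensive.

Import Order.TTheory GRing.Theory Num.Theory.
Import numFieldNormedType.Exports.

Local Open Scope classical_set_scope.
Local Open Scope ring_scope.

(* Over a real field the involution of the Hermitian form is the identity, so
   [{dot H for idfun}] is the type of symmetric positive definite bilinear
   forms.  The second field makes the norm of [H], hence its topology and
   completeness, those of the inner product. *)
HB.mixin Record isHilbert (R : realType) H of CompleteNormedModule R H := {
  inner : {dot H for (@idfun R)} ;
  sqr_normrE : forall x : H, `|x| ^+ 2 = inner x x
}.

#[short(type="hilbertType")]
HB.structure Definition Hilbert (R : realType) :=
  {H of isHilbert R H & CompleteNormedModule R H}.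

(* The payoffs are defined on the strategy sets only: a set coerces to the
   subtype of its elements. *)
Record two_person_game (R : realType) (T1 T2 : Type) := TwoPersonGame {
  strategies1 : set T1 ;
  strategies2 : set T2 ;
  strategies1_neq0 : strategies1 !=set0 ;
  strategies2_neq0 : strategies2 !=set0 ;
  payoff1 : strategies1 -> strategies2 -> R ;
  payoff2 : strategies1 -> strategies2 -> R
}.

Definition nash_equilibrium (R : realType) (T1 T2 : Type)
    (G : two_person_game R T1 T2)
    (pbar : strategies1 G) (qbar : strategies2 G) : Prop :=
  (forall p : strategies1 G, payoff1 p qbar <= payoff1 pbar qbar) /\
  (forall q : strategies2 G, payoff2 pbar q <= payoff2 pbar qbar).

Arguments nash_equilibrium {R T1 T2} G pbar qbar.

(* Main.v *)
Require Import Defs.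
From HB Require Import structures.
From mathcomp Require Import all_boot all_order all_algebra finmap.
From mathcomp Require Import all_classical all_reals all_analysis.
From mathcomp Require Import ring lra.

(** An equilibrium is a point [z] of the compact convex set
    [K = Omega1 * Omega2] such that [b w z <= b z z] for every [w] in [K],
    where [b w z = <w1, A z2> + <w2, B z1>]: comparing [z] with the points
    which differ from it in one coordinate gives the two inequalities of the
    definition.  The existence of [z] is an instance of Ky Fan's inequality
    ([bilinear_ky_fan]); it is reduced to a finite problem by compactness.  For
    finitely many points [w_i] of [K] and a tolerance [eps], look for [z] among
    the convex combinations [\sum_i x_i w_i]; since [b] is bilinear, the
    conditions on [x] only involve the matrix [M i j = b w_i w_j], and say that
    the mixed strategy [x] is, up to [eps], a symmetric equilibrium of the
    symmetric game [M] ([approx_symmetric_equilibrium]).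

    That finite problem is solved on the grid of the simplex, the points with
    coordinates [x_i / N], [x_i] natural numbers with sum [N].  Colour [x] with
    an index [i] for which the payoff [(M x)_i] is largest.  A Sperner type
    argument ([grid_rainbow]) produces a cluster of grid points, any two of
    them close together, which exhibits every colour [i] but those for which
    the [i]-th coordinate is nearly [0] on the cluster.  Hence, at a point of
    the cluster, every pure strategy of non negligible weight is nearly a best
    reply.

    The combinatorial core is Scarf's order-theoretic form of Sperner's lemma
    ([dominant_rainbow]).  It needs no triangulation: the simplices are
    replaced by the sets which are dominant for a family of total orders, one
    for each colour.  Fix a colour [i0] and let [n] be the number of colours.
    As in the usual proof, the dominant sets with [n] elements are rooms, and
    the dominant sets with [n - 1] elements which carry each colour but [i0]
    once are doors.  A door belongs to two rooms, except for one door, on the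
    boundary, which belongs to a single room ([odd_extensions]); a room has an
    odd number of doors only if it carries all the colours
    ([odd_almost_rainbow]).  Counting the pairs of a room and one of its doors
    modulo 2 yields a room with all the colours. *)

Set Implicit Arguments.
Unset Strict Implicit.
Unset Printing Implicit Defensive.

Import Order.TTheory GRing.Theory Num.Theory.
Import numFieldNormedType.Exports.

(** * Dominant sets and Scarf's lemma *)

Section Combinatorics.

(* Many names of finite set theory are shared with classical set theory. *)
Import mathcomp.boot.fintype mathcomp.boot.finset.

Section Scarf.
Variables (T I : finType) (r : I -> T -> nat) (s : I -> T).
Hypothesis r_inj : forall i, injective (r i).
(* The boundary points [s i] play the part of the vertices of a large simplex
   around the other points.  They give every dominant set a neighbour across
   each of its faces, except across one outer face for each order. *)
Hypothesis s_inj : injective s.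
Hypothesis s_min : forall i x, r i (s i) <= r i x.
Hypothesis s_max :
  forall i j x, i != j -> x \notin codom s -> r j x < r j (s i).

(** Scarf's dominant (or primitive) sets, which stand for the simplices of a
    triangulation and their faces.  The total orders are given by injective
    rank functions. *)
Definition dominant (S : {set T}) :=
  [forall y, exists i, forall x in S, r i y <= r i x].

Definition extensions (D : {set T}) :=
  [set y | (y \notin D) && dominant (y |: D)].

Lemma dominantP (S : {set T}) :
  reflect (forall y, exists i, {in S, forall x, r i y <= r i x}) (dominant S).
Proof.
apply: (iffP forallP) => dS y.
  by have /existsP[i /forall_inP leS] := dS y; exists i.
by have [i leS] := dS y; apply/existsP; exists i; apply/forall_inP.
Qed.

Arguments dominantP {S}.

Lemma dominantS (S S' : {set T}) : S \subset S' -> dominant S' -> dominant S.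
Proof.
move=> /subsetP sSS' /dominantP dS'; apply/dominantP => y.
by have [i leS'] := dS' y; exists i => x /sSS'; exact: leS'.
Qed.

Lemma rank_lt i x y : r i x <= r i y -> x != y -> r i x < r i y.
Proof. by rewrite leq_eqVlt => /predU1P[/r_inj->|//]; rewrite eqxx. Qed.

(** How a dominant set [D] with one element less than there are orders extends
    to dominant sets with one more element.  [m i] is the least element of [D]
    for the order [i]; dominance makes [m] onto, so that by counting exactly
    two orders [a] and [b] share their least element. *)
Section Door.
Variables (D : {set T}) (m : I -> T).
Hypothesis dominantD : dominant D.
Hypothesis cardD : #|D|.+1 = #|I|.
Hypothesis mD : forall i, m i \in D.
Hypothesis m_min : forall i, {in D, forall x, r i (m i) <= r i x}.

(** The points which fail to contradict the dominance of [D] only because of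
    the order [a]. *)
Definition above a :=
  [set z | [forall i, (i != a) ==> (r i (m i) < r i z)]].

Definition top a := [set y in above a | [forall z in above a, r a z <= r a y]].

Lemma aboveP a z :
  reflect (forall i, i != a -> r i (m i) < r i z) (z \in above a).
Proof.
rewrite inE; apply: (iffP forallP) => h i; first exact/implyP/h.
exact/implyP/h.
Qed.

Arguments aboveP {a z}.

Lemma topP a y :
  reflect (y \in above a /\ {in above a, forall z, r a z <= r a y})
    (y \in top a).
Proof.
by rewrite /top in_set; apply: (iffP andP) => -[? /forall_inP ?]; split=> //; apply/forall_inP.
Qed.

Arguments topP {a y}.

Lemma dominant_above a z x : z \in above a -> x \in D -> r a z <= r a x.
Proof.
move=> /aboveP zP xD; have [i le_z] := dominantP dominantD z.
have [<-|ia] := eqVneq i a; first exact: le_z.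
by have := zP i ia; rewrite ltnNge le_z.
Qed.

Lemma min_unique i x : x \in D -> {in D, forall z, r i x <= r i z} -> x = m i.
Proof. by move=> xD le_x; apply/(@r_inj i)/anti_leq; rewrite le_x// m_min. Qed.

Lemma min_onto x : x \in D -> exists i, x = m i.
Proof.
move=> xD; have [i le_x] := dominantP dominantD x.
by exists i; apply: min_unique.
Qed.

(** [m] maps a set of size [#|D| + 1] onto [D], and remains onto when one of two
    orders with the same least element is left out; it is then a bijection. *)
Lemma min_double : exists a b, [/\ a != b, m a = m b &
  forall i j, i != j -> m i = m j -> i \in [set a; b]].
Proof.
have mI : [set m i | i in I] = D.
  apply/setP => x; apply/imsetP/idP => [[i _ ->//]|/min_onto[i ->]].
  by exists i.
have /injectivePn[a [b ab mab]] : ~~ injectiveb m.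
  apply/negP => /injectiveP m_inj.
  have := card_imset I m_inj; rewrite mI => /eqP.
  by rewrite -[#|[eta I]|]cardD ltn_eqF.
have inj_but i k : i != k -> m i = m k -> {in [set~ i] &, injective m}.
  move=> ik mik; apply/imset_injP; rewrite cardsC1 -cardD/=; apply/eqP.
  congr #|pred_of_set _|; apply/setP => x.
  apply/imsetP/idP => [[j _ ->//]|/min_onto[j ->]].
  have [->|ji] := eqVneq j i; last by exists j; rewrite ?inE.
  by exists k; rewrite ?inE 1?eq_sym.
exists a, b; split=> // i j ij mij; rewrite !inE.
apply/norP => -[ia ib].
have [ja|ja] := eqVneq j a.
  move/eqP: ij; apply; apply: (inj_but b a) => //; rewrite ?inE ?ja//.
  by rewrite eq_sym.
by move/eqP: ij; apply; apply: (inj_but a b) => //; rewrite ?inE.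
Qed.

(** In [y |: D] every element must be least for some order.  So [y] takes over
    an order that its owner can spare, which is [a] or [b]; if it takes over
    [a], then it is above [D] for the other orders, and dominance forces it to
    be the largest such point for the order [a]. *)
Lemma mem_extensions a b y : a != b -> m a = m b ->
  (forall i j, i != j -> m i = m j -> i \in [set a; b]) ->
  (y \in extensions D) = (y \in top a) || (y \in top b).
Proof.
move=> ab mab double; have top_ext c d : c != d -> m c = m d ->
    y \in top c -> y \in extensions D.
  move=> cd mcd /topP[yc ymax]; rewrite inE; apply/andP; split.
    apply/negP => yD; have [j yj] := min_onto yD.
    have jc : j = c.
      by apply/eqP/negPn/negP => /(aboveP yc); rewrite -yj ltnn.
    by have := aboveP yc d; rewrite eq_sym cd yj jc mcd ltnn => /(_ isT).
  apply/dominantP => z; have [zc|] := boolP (z \in above c).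
    exists c => x /setU1P[->|xD]; first exact: ymax.
    exact: dominant_above.
  rewrite inE negb_forall => /existsP[i]; rewrite negb_imply -leqNgt.
  move=> /andP[ic zi]; exists i => x /setU1P[->|xD].
    by rewrite (leq_trans zi)// ltnW// (aboveP yc).
  by rewrite (leq_trans zi)// m_min.
have ba : b != a by rewrite eq_sym.
apply/idP/orP => [|[/(top_ext _ _ ab mab)//|/(top_ext _ _ ba (esym mab))//]].
rewrite inE => /andP[yD /dominantP dyD].
have still x : x \in D -> exists2 j, m j = x & r j x < r j y.
  move=> xD; have [j le_x] := dyD x; exists j.
    by apply/esym/min_unique => // z zD; apply: le_x; rewrite setU1r.
  apply: rank_lt; first by apply: le_x; rewrite setU11.
  by apply: contraNneq yD => <-.
have [i0 le_y] := dyD y.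
have lt_y : r i0 y < r i0 (m i0).
  by apply: rank_lt; [apply: le_y; rewrite setU1r|apply: contraNneq yD => ->].
have i0ab : i0 \in [set a; b].
  have [j mj ltj] := still _ (mD i0); apply: (double _ j) => //.
  by apply: contraTneq ltj => <-; rewrite -leqNgt ltnW.
suff: y \in top i0 by move: i0ab; rewrite !inE => /orP[]/eqP-> ->; [left|right].
apply/topP; split.
  apply/aboveP => i ii0; have [j mj ltj] := still _ (mD i).
  have [<-|ji] := eqVneq j i; first by rewrite -mj in ltj.
  have ji0 : j != i0.
    by apply: contraTneq ltj => ->; rewrite -leqNgt ltnW// (leq_trans lt_y)// m_min.
  have ij : i != j by rewrite eq_sym.
  have /set2P iab := double _ _ ij (esym mj); have /set2P jab := double _ _ ji mj.
  move: ij ji0 ii0; case/set2P: i0ab => ->; case: iab => ->; case: jab => ->;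
  by rewrite ?eqxx.
move=> z /aboveP zP; have [i le_z] := dyD z.
have [<-|ii0] := eqVneq i i0; first by apply: le_z; rewrite setU11.
by have := zP i ii0; rewrite ltnNge le_z// setU1r.
Qed.

Lemma card_top a : #|top a| = (above a != set0).
Proof.
have [a0|/set0Pn[z0 z0a]] := eqVneq (above a) set0.
  by apply/eqP; rewrite cards_eq0; apply/eqP/setP => y; rewrite /top a0 !inE.
apply/eqP/cards1P.
have [y ya ymax] := arg_maxnP (r a) z0a; exists y; apply/setP => z.
rewrite inE; apply/topP/eqP => [[za zmax]|->]; last by split.
apply/(@r_inj a)/anti_leq/andP; split; first exact: ymax.
exact: zmax.
Qed.

Lemma card_extensions_double a b : a != b -> m a = m b ->
  (forall i j, i != j -> m i = m j -> i \in [set a; b]) ->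
  #|extensions D| = (above a != set0) + (above b != set0).
Proof.
move=> ab mab double; rewrite -!card_top.
have -> : extensions D = top a :|: top b.
  by apply/setP => y; rewrite (mem_extensions _ ab)// in_setU.
rewrite cardsU -[RHS]subn0; congr (_ - _); apply/eqP.
rewrite cards_eq0 -subset0; apply/subsetP => y; rewrite in_setI.
move=> /andP[/topP[ya _] /topP[/aboveP yb _]].
have := dominant_above ya (mD a).
by rewrite leqNgt yb.
Qed.

(** Both [above a] and [above b] are inhabited by boundary points as soon as
    [D] has an ordinary element.  If [D] is a face of the boundary simplex, the
    missing colour [c] is one of [a] and [b]; the missing vertex then lies
    above [D] but for [c], while nothing lies above [D] on the other side. *)
Lemma odd_extensions_min :
  odd #|extensions D| = [exists c, D == s @: [set~ c]].
Proof.
have [a [b [ab mab double]]] := min_double.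
rewrite (card_extensions_double ab mab double).
have [/existsP[c /eqP Dc]|Ds] := boolP [exists c, D == s @: [set~ c]]; last first.
  move: Ds; rewrite negb_exists => /forallP Ds.
  have /subsetPn[x xD xs] : ~~ (D \subset s @: I).
    apply/negP => /subsetP Dsub; have [c cD] : exists c, s c \notin D.
      apply/existsP; rewrite -negb_forall; apply/negP => /forallP sD.
      have : s @: I \subset D by apply/subsetP => _ /imsetP[i _ ->].
      move/subset_leq_card; rewrite card_imset// -[#|[eta I]|]/#|I|.
      by rewrite -cardD ltnn.
    have := Ds c; rewrite eqEcard card_imset// cardsC1 -cardD leqnn andbT.
    move=> /negP; apply; apply/subsetP => x xD.
    have /imsetP[i _ xi] := Dsub _ xD; rewrite xi imset_f// !inE.
    by apply: contraNneq cD => <-; rewrite -xi.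
  (* The ordinary element [x] of [D] bounds the least elements of [D], for all
     the orders but [k], by the boundary point [s k]. *)
  suff above_s k : above k != set0 by rewrite !above_s.
  apply/set0Pn; exists (s k); apply/aboveP => i ik.
  apply: leq_ltn_trans (m_min i xD) _; apply: s_max; first by rewrite eq_sym.
  by apply: contra xs => /codomP[j ->]; rewrite imset_f.
have ms i : i != c -> m i = s i.
  by move=> ic; apply/esym/min_unique => //; rewrite Dc imset_f// !inE.
(* The order [c] has lost its vertex and shares the one of [a'].
   Thus [c] and [a'] are the two orders of [min_double]. *)
have [a' a'c mc] : exists2 a', a' != c & m c = s a'.
  by have := mD c; rewrite Dc => /imsetP[k]; rewrite !inE => kc ->; exists k.
have above_c : above c != set0.
  apply/set0Pn; exists (s c); apply/aboveP => i ic; rewrite ms//.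
  by apply: rank_lt => //; rewrite (inj_eq s_inj).
have above_a' : above a' == set0.
  rewrite -subset0; apply/subsetP => z /aboveP zP.
  have zc : r c (s a') < r c z by rewrite -mc; apply: zP; rewrite eq_sym.
  have [/codomP[k zk]|zs] := boolP (z \in codom s); last first.
    by move: (s_max a'c zs); rewrite ltnNge ltnW.
  have [ka|ka] := eqVneq k a'; first by rewrite zk ka ltnn in zc.
  have [kc|kc] := eqVneq k c; first by rewrite zk kc ltnNge s_min in zc.
  by have := zP k ka; rewrite ms// zk ltnn.
have ca' : c != a' by rewrite eq_sym.
have /set2P a'ab := double _ _ a'c (etrans (ms _ a'c) (esym mc)).
have /set2P cab := double _ _ ca' (etrans mc (esym (ms _ a'c))).
move: a'c above_c above_a'; case: a'ab => ->; case: cab => ->;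
by rewrite ?eqxx// => _ -> ->.
Qed.

End Door.

Lemma odd_extensions (D : {set T}) : 1 < #|I| -> #|D|.+1 = #|I| -> dominant D ->
  odd #|extensions D| = [exists c, D == s @: [set~ c]].
Proof.
move=> I1 cardD dD.
have /set0Pn[x0 x0D] : D != set0 by rewrite -card_gt0 -ltnS cardD.
pose m i := [arg min_(x < x0 in D) r i x].
have mP i : m i \in D /\ {in D, forall x, r i (m i) <= r i x}.
  by rewrite /m; case: arg_minnP.
by apply: (@odd_extensions_min D m) => // i; case: (mP i).
Qed.

Lemma dominant_slack c : dominant (s @: [set~ c]).
Proof.
apply/dominantP => y; have [/codomP[k ->]|ys] := boolP (y \in codom s).
  by exists k => x _; exact: s_min.
exists c => z /imsetP[j]; rewrite !inE => jc ->.
by rewrite ltnW// s_max.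
Qed.

(** If removing [x] leaves all the colours but [i0], once each, then either [x]
    has the colour [i0] and [S] is rainbow, or exactly one other element [x']
    has the colour of [x], and [x] and [x'] are the only such elements. *)
Lemma odd_almost_rainbow (c : T -> I) (S : {set T}) i0 : #|S| = #|I| ->
  odd #|[set x in S | c @: (S :\ x) == [set~ i0]]| -> c @: S = [set: I].
Proof.
move=> cardS; set A := [set x in S | _].
have [->|[x]] := set_0Vmem A; first by rewrite cards0.
rewrite inE => /andP[xS /eqP cSx].
have [cx|cx] := eqVneq (c x) i0.
  move=> _; apply/setP => i; rewrite inE; have [->|ii0] := eqVneq i i0.
    by rewrite -cx imset_f.
  have : i \in c @: (S :\ x) by rewrite cSx !inE.
  by move=> /imsetP[y]; rewrite inE => /andP[_ yS] ->; exact: imset_f.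
have /imsetP[x'] : c x \in c @: (S :\ x) by rewrite cSx !inE.
move=> x'Sx cxx'; have := x'Sx; rewrite !inE => /andP[x'x x'S].
have c_inj : {in S :\ x &, injective c}.
  by apply/imset_injP; rewrite cSx cardsC1 -cardS (cardsD1 x S) xS.
suff -> : A = [set x; x'] by rewrite cards2 eq_sym x'x.
apply/setP => y; rewrite [y \in A]inE in_set2.
apply/andP/orP => [[yS /eqP cSy]|[]/eqP->]; first last.
- split=> //; rewrite -cSx; apply/eqP/setP => i.
  apply/imsetP/imsetP => -[z]; rewrite !inE => /andP[zx zS] ->.
    have [->|zx'] := eqVneq z x; first by exists x'.
    by exists z; rewrite // !inE zx' zS.
  have [->|zx'] := eqVneq z x'; last by exists z; rewrite // !inE zx' zS.
  by exists x; rewrite // !inE eq_sym x'x.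
- by split=> //; rewrite cSx.
have [_|yx] := eqVneq y x; first by left.
have [_|yx'] := eqVneq y x'; first by right.
have ySx : y \in S :\ x by rewrite !inE yx.
have : c y \in c @: (S :\ y) by rewrite cSy -cSx imset_f.
move=> /imsetP[z]; rewrite !inE => /andP[zy zS] cyz.
have [zx|zx] := eqVneq z x.
  by move/eqP: yx'; case; apply: c_inj; rewrite // cyz zx.
by move/eqP: zy; case; apply: c_inj; rewrite ?inE ?zx ?zS -?cyz ?yx.
Qed.

(** Scarf's form of Sperner's lemma, by counting in two ways the pairs of a
    room and one of its doors. *)
Lemma dominant_rainbow (c : T -> I) : 1 < #|I| -> (forall i, c (s i) = i) ->
  exists S : {set T}, [/\ dominant S, #|S| = #|I| & c @: S = [set: I]].
Proof.
move=> I1 cs; have /card_gt0P[i0 _] : 0 < #|I| by apply: ltnW.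
pose almost (D : {set T}) := c @: D == [set~ i0].
pose room (S : {set T}) := dominant S && (#|S| == #|I|).
pose door (D : {set T}) := [&& dominant D, #|D|.+1 == #|I| & almost D].
have count : \sum_(D | door D) #|extensions D| =
             \sum_(S | room S) #|[set x in S | almost (S :\ x)]|.
  under eq_bigr => D _ do rewrite -sum1_card.
  under [RHS]eq_bigr => S _ do rewrite -sum1_card.
  rewrite !pair_big_dep/=.
  rewrite (reindex_onto (fun p => (p.1 :\ p.2, p.2)) (fun p => (p.2 |: p.1, p.2)))/=.
    apply: eq_bigl => -[S x]/=; rewrite !inE eqxx/= xpair_eqE eqxx andbT /room.
    have [xS|xS] := boolP (x \in S); last first.
      rewrite andbF; apply/negbTE; rewrite negb_and.
      by apply/orP; right; apply: contra xS => /eqP<-; rewrite setU11.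
    rewrite setD1K// eqxx andbT /door (cardsD1 x S) xS add1n.
    case: (boolP (dominant S)) => [dS|_]; last by rewrite andbF.
    rewrite (dominantS _ dS) ?subsetDl//.
    by rewrite !andbT.
  by move=> [D x]/= /andP[_]; rewrite inE => /andP[xD _]; rewrite setU1K.
have slack_door : door (s @: [set~ i0]).
  rewrite /door dominant_slack card_imset// cardsC1 (ltn_predK I1) eqxx/=.
  rewrite /almost -imset_comp (eq_imset _ cs) imset_id//.
have odd_doors : odd (\sum_(D | door D) #|extensions D|).
  rewrite (bigD1 (s @: [set~ i0]))//= oddD.
  have /and3P[dD /eqP cardD _] := slack_door.
  have -> : odd #|extensions (s @: [set~ i0])|.
    by rewrite odd_extensions//; apply/existsP; exists i0.
  rewrite addTb; elim/big_ind: _ => // [k l|D /andP[/and3P[dD' /eqP cardD' aD]]].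
    by rewrite oddD => /negbTE-> /negbTE->.
  rewrite odd_extensions//; apply: contra => /existsP[k /eqP Dk].
  move: aD; rewrite /almost Dk -imset_comp (eq_imset _ cs) imset_id => /eqP.
  by move/setC_inj/set1_inj ->.
have [S /andP[/andP[dS /eqP cardS] oS]] : exists S, room S &&
    odd #|[set x in S | almost (S :\ x)]|.
  apply/existsP; apply: contraTT odd_doors; rewrite negb_exists => /forallP noS.
  rewrite count; elim/big_ind: _ => // [k l|S rS].
    by rewrite oddD => /negbTE-> /negbTE->.
  by have := noS S; rewrite rS.
by exists S; split=> //; exact: odd_almost_rainbow oS.
Qed.

End Scarf.

(** The same statement for points with natural number coordinates [h i x]: the
    orders are refined into total ones by breaking ties with the enumeration of
    the points, and the boundary points, one for each colour, are adjoined.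
    The set [C] consists of the colours whose boundary point is left out by the
    rainbow dominant set, and which are thus carried by ordinary points. *)
Lemma coloring_dominant (I G : finType) (h : I -> G -> nat) (c : G -> I) : 1 < #|I| ->
  exists (S : {set G}) (C : {set I}),
    (forall y, exists2 i, i \in C & {in S, forall x, h i y <= h i x}) /\
    {in C, forall i, exists2 x, x \in S & c x = i}.
Proof.
move=> I1; pose B := \sum_i \sum_x h i x.
have hB i x : h i x < B.+1.
  by rewrite ltnS /B (bigD1 i)//= (bigD1 x)//= -addnA leq_addr.
pose T := (G + I)%type.
pose r i (z : T) := match z with
  | inl x => (h i x * #|G| + enum_rank x).+1
  | inr j => if j == i then 0 else (B.+1 * #|G| + enum_rank j).+1
  end.
pose slack i : T := inr i.
(* The ranks are the codes in base [#|G|] of lexicographic pairs. *)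
have lex (a b : nat) (x : G) d : a < b -> a * #|G| + enum_rank x < b * #|G| + d.
  move=> ab; apply: leq_trans (leq_addr _ _).
  apply: (@leq_trans (a.+1 * #|G|)); last by rewrite leq_mul2r ab orbT.
  by rewrite mulSn addnC -addSn leq_add2r; exact: ltn_ord.
have r_lt i (x y : G) : h i x < h i y -> r i (inl x) < r i (inl y).
  by move=> xy; rewrite /= ltnS lex.
have r_slack i j (x : G) : i != j -> r j (inl x) < r j (inr i).
  by move=> ij; rewrite /= (negbTE ij) ltnS lex.
have [] := @dominant_rainbow T I r slack _ _ _ _
  (fun z => match z with inl x => c x | inr j => j end) I1 _ => //.
- move=> i [x|j] [y|k].
  + move=> rxy; congr inl; have hxy : h i x = h i y.
      case: (ltngtP (h i x) (h i y)) => // /r_lt/ltn_eqF/eqP; case; first exact: rxy.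
      exact: esym rxy.
    move: rxy => /= [] + ; rewrite hxy => /eqP; rewrite eqn_add2l => /eqP.
    by move=> /val_inj/enum_rank_inj.
  + have [->|ki] := eqVneq k i; first by rewrite /r eqxx.
    by move=> e; have := r_slack _ _ x ki; rewrite e ltnn.
  + have [->|ki] := eqVneq j i; first by rewrite /r eqxx.
    by move=> e; have := r_slack _ _ y ki; rewrite e ltnn.
  + rewrite /r; case: eqVneq => [->|ji]; case: eqVneq => [->|ki]//.
    move=> [] /eqP; rewrite eqn_add2l => /eqP.
    by move=> /val_inj/enum_rank_inj ->.
- by move=> i j [].
- by move=> i x; rewrite /= eqxx.
- by move=> i j [x|k] ij; [move=> _; exact: r_slack|rewrite codom_f].
move=> S [/dominantP domS _ rainbowS].
exists [set x | inl x \in S], [set i | inr i \notin S]; split.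
  move=> y; have [i iP] := domS (inl y); exists i => [|x].
    by rewrite inE; apply/negP => /iP; rewrite /= eqxx.
  by rewrite inE leqNgt => xS; apply/negP => /r_lt; rewrite ltnNge iP.
move=> i; rewrite inE => iS; have : i \in [set: I] by rewrite inE.
rewrite -rainbowS => /imsetP[[x|j] zS ij]; first by exists x; rewrite ?inE.
by move: iS; rewrite ij zS.
Qed.

(** On the grid of the simplex, dominance alone bounds the diameter: if [m] is
    the coordinatewise minimum of the dominant set ([0] for the colours which
    are not in [C]), then the sum of [m] is almost [N], for otherwise
    some grid point would exceed [m] in all the coordinates of [C]; and all
    the points of the set lie above [m] and have sum [N].  A colour without a
    nearby point belongs to a coordinate which is close to [0]. *)
Lemma grid_rainbow (I : finType) (N : nat) (c : (I -> nat) -> I) : 1 < #|I| ->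
  exists x : I -> nat, \sum_i x i = N /\
    forall i, x i <= #|I| \/
      exists2 y : I -> nat, c y = i &
        forall j, x j <= y j + #|I| /\ y j <= x j + #|I|.
Proof.
move=> I1; have /card_gt0P[i0 _] : 0 < #|I| by apply: ltnW.
pose G := {x : {ffun I -> 'I_N.+1} | \sum_i x i == N}.
pose co (x : G) i : nat := val x i.
have sum_co (x : G) : \sum_i co x i = N by apply/eqP; exact: (valP x).
have mk_point (y : I -> nat) : \sum_i y i = N -> exists z : G, co z =1 y.
  move=> yN; have yle i : y i < N.+1 by rewrite ltnS -yN (bigD1 i)//= leq_addr.
  pose z := [ffun i => Ordinal (yle i)].
  have zP : \sum_i z i == N by apply/eqP; rewrite -[RHS]yN; apply: eq_bigr => i _; rewrite ffunE.
  by exists (exist _ z zP) => i; rewrite /co/= ffunE.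
have [S [C [domS colour]]] := coloring_dominant (fun i x => co x i) (fun x => c (co x)) I1.
have [i1 i1C] : exists i, i \in C.
  have [z _] : exists z : G, co z =1 fun i => if i == i0 then N else 0.
    by apply: mk_point; rewrite -big_mkcond/= big_pred1_eq.
  by have [i iC _] := domS z; exists i.
have [z0 z0S _] := colour _ i1C.
pose m i := if i \in C then co [arg min_(x < z0 in S) co x i] i else 0.
have m_le i x : x \in S -> m i <= co x i.
  by rewrite /m; case: ifP => // _ xS; case: arg_minnP => // z _; apply.
have N_le : N <= \sum_i m i + #|I|.
  rewrite leqNgt; apply/negP => sumN.
  (* The excess of the sum is put on a coordinate of [C], so that the resulting
     grid point beats the dominant set in all the orders of [C]. *)
  have [z zE] : exists z : G,
      co z =1 fun i => (m i).+1 + if i == i1 then N - (\sum_i m i + #|I|) else 0.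
    apply: mk_point; rewrite big_split/= -big_mkcond/= big_pred1_eq.
    under eq_bigr do rewrite -addn1.
    by rewrite big_split/= sum1_card subnKC// ltnW.
  have [i iC] := domS z; rewrite zE.
  move=> /(_ [arg min_(x < z0 in S) co x i]).
  have -> : co [arg min_(x < z0 in S) co x i] i = m i by rewrite /m iC.
  case: arg_minnP => // x xS _ /(_ xS).
  by rewrite leqNgt ltnS leq_addr.
have co_le i x : x \in S -> co x i <= m i + #|I|.
  move=> xS; move: N_le; rewrite -(sum_co x) (bigD1 i)//= [X in _ <= X + _](bigD1 i)//=.
  have : \sum_(j | j != i) m j <= \sum_(j | j != i) co x j.
    by apply: leq_sum => j _; exact: m_le.
  rewrite -addnA [_ + #|I|]addnC addnA => le1 le2.
  by rewrite -(leq_add2r (\sum_(j | j != i) co x j)) (leq_trans le2)// leq_add2l.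
exists (co z0); split=> // i; have [iC|iC] := boolP (i \in C); last first.
  by left; apply: leq_trans (co_le _ _ z0S) _; rewrite /m (negbTE iC).
right; have [x xS xi] := colour i iC; exists (co x) => // j.
by split; apply: leq_trans (co_le _ _ _) _; rewrite // leq_add2r m_le.
Qed.

End Combinatorics.

(** * Approximate symmetric equilibria of matrix games *)

Local Open Scope classical_set_scope.
Local Open Scope ring_scope.

(** Apply [grid_rainbow] to the colouring of a grid point by one of its best
    replies [i].  A coordinate [i] with a nearby point of colour [i] is nearly a
    best reply; the others have weight at most [n / N].  With [K] a bound of
    the entries of [M], the total error is at most [4 * K * n ^+ 2 / N]. *)
Lemma approx_symmetric_equilibrium (R : archiRealFieldType) (I : finType)
    (M : I -> I -> R) (eps : R) : (1 < #|I|)%N -> 0 < eps ->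
  exists x : I -> R, [/\ forall i, 0 <= x i, \sum_i x i = 1 &
    forall j, \sum_k M j k * x k <= \sum_i x i * (\sum_k M i k * x k) + eps].
Proof.
move=> I1 eps0; have /card_gt0P[i0 _] : (0 < #|I|)%N by apply: ltnW.
pose n : R := #|I|%:R.
pose K := \sum_i \sum_j `|M i j|.
have MK i j : `|M i j| <= K.
  rewrite /K (bigD1 i)//= (bigD1 j)//= -addrA lerDl addr_ge0//.
    by rewrite sumr_ge0.
  by rewrite sumr_ge0// => k _; rewrite sumr_ge0.
have K0 : 0 <= K by apply: le_trans (MK i0 i0).
have n0 : 0 <= n by rewrite ler0n.
have [N N0 NK] : exists2 N, (0 < N)%N & 4 * K * n ^+ 2 <= eps * N%:R.
  exists (Num.bound (4 * K * n ^+ 2 / eps)).+1 => //.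
  rewrite -ler_pdivrMl// mulrC; apply/ltW.
  have KN : 0 <= 4 * K * n ^+ 2 / eps.
    by rewrite divr_ge0 ?mulr_ge0 ?exprn_ge0// ltW.
  by apply: lt_le_trans (archi_boundP KN) _; rewrite ler_nat.
pose f (x : I -> nat) i := \sum_k M i k * (x k)%:R.
have [x [sumx xP]] :=
  @grid_rainbow I N (fun x => [arg max_(i > i0) f x i]%O) I1.
have f_close (y z : I -> nat) i :
    (forall k, y k <= z k + #|I| /\ z k <= y k + #|I|)%N ->
    f y i <= f z i + K * n ^+ 2.
  move=> yz; rewrite -lerBlDl /f -sumrB.
  apply: (@le_trans _ _ (\sum_(k : I) K * n)); last first.
    by rewrite sumr_const -[#|_|]/#|I| -mulr_natr -/n expr2 mulrA.
  apply: ler_sum => k _; rewrite -mulrBr (le_trans (ler_norm _))//.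
  have [yz1 yz2] := yz k; rewrite normrM ler_pM// ler_norml; apply/andP; split.
    by rewrite lerBrDr addrC lerBlDr -natrD ler_nat.
  by rewrite lerBlDr -natrD ler_nat addnC.
have f_bound i : `|f x i| <= K * N%:R.
  rewrite (le_trans (ler_norm_sum _ _ _))// -sumx natr_sum mulr_sumr.
  by apply: ler_sum => k _; rewrite normrM normr_nat ler_wpM2r.
(* A small weight meets a gap of at most [2 * K * N]; an arbitrary weight meets
   a gap of at most two variations of [f] over the cluster. *)
have term i j :
    (x i)%:R * (f x j - f x i) <= (x i)%:R * (2 * (K * n ^+ 2)) + 2 * n * (K * N%:R).
  have [xi|[y cy xy]] := xP i.
    apply: (@le_trans _ _ (n * (2 * (K * N%:R)))); last first.
      have : 0 <= (x i)%:R * (2 * (K * n ^+ 2)) by rewrite !mulr_ge0// exprn_ge0.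
      by lra.
    have := f_bound i; have := f_bound j; rewrite !ler_norml => /andP[_ fj] /andP[fi _].
    apply: (@le_trans _ _ ((x i)%:R * (2 * (K * N%:R)))).
      by rewrite ler_wpM2l//; lra.
    by rewrite ler_wpM2r ?ler_nat// !mulr_ge0.
  have fmax : f y j <= f y i.
    by rewrite -cy; case: arg_maxP => // k _; apply.
  have f1 := f_close x y j xy.
  have f2 : f y i <= f x i + K * n ^+ 2.
    by apply: f_close => k; have [] := xy k.
  rewrite -[leLHS]addr0 lerD ?ler_wpM2l//; last by rewrite !mulr_ge0.
  by lra.
have NR : 0 < N%:R :> R by rewrite ltr0n.
exists (fun i => (x i)%:R / N%:R); split.
- by move=> i; rewrite divr_ge0.
- by rewrite -mulr_suml -natr_sum sumx divff// gt_eqF.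
move=> j /=.
have fN i : \sum_k M i k * ((x k)%:R / N%:R) = f x i / N%:R.
  by rewrite /f mulr_suml; apply: eq_bigr => k _; rewrite mulrA.
rewrite fN.
have : \sum_i (x i)%:R * (f x j - f x i) <=
   \sum_i ((x i)%:R * (2 * (K * n ^+ 2)) + 2 * n * (K * N%:R)).
  by apply: ler_sum => i _.
have -> : \sum_i (x i)%:R * (f x j - f x i) =
    N%:R * f x j - \sum_i (x i)%:R * f x i.
  rewrite -sumx natr_sum mulr_suml -sumrB.
  by apply: eq_bigr => i _; rewrite mulrBr.
rewrite big_split/= -mulr_suml -natr_sum sumx sumr_const -[#|_|]/#|I| -[_ *+ #|I|]mulr_natr -/n.
have -> : \sum_i (x i)%:R / N%:R * (\sum_k M i k * ((x k)%:R / N%:R)) =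
    (\sum_i (x i)%:R * f x i) / N%:R ^+ 2.
  by rewrite mulr_suml; apply: eq_bigr => i _; rewrite fN; field; rewrite gt_eqF.
set S := \sum_i _ => le1.
have -> : S / N%:R ^+ 2 + eps = (S + (eps * N%:R) * N%:R) / N%:R ^+ 2.
  by field; rewrite gt_eqF.
rewrite ler_pdivlMr ?exprn_gt0//.
have -> : f x j / N%:R * N%:R ^+ 2 = N%:R * f x j by field; rewrite gt_eqF.
have := ler_wpM2r (ltW NR) NK.
move: le1; lra.
Qed.

(** * Ky Fan's inequality for bilinear forms *)

Lemma convex_set_sum (R : realFieldType) (V : lmodType R) (K : set V) n
    (x : 'I_n -> R) (w : 'I_n -> V) : convex_set K ->
  (forall i, 0 <= x i) -> \sum_i x i = 1 -> (forall i, K (w i)) ->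
  K (\sum_i x i *: w i).
Proof.
move=> Kconv; elim: n x w => [|n IH] x w x0 x1 Kw.
  by move: x1; rewrite big_ord0 => /esym/eqP; rewrite oner_eq0.
move: x1; rewrite !big_ord_recl.
set t := x ord0; set u := \sum_(i < n) x (lift ord0 i) => tu.
have u0 : 0 <= u by apply: sumr_ge0.
have t01 : 0 <= t <= 1 by rewrite x0/= -tu lerDl.
have [u_eq0|u_neq0] := eqVneq u 0.
  rewrite big1 => [|i _]; first by rewrite addr0 -[t]addr0 -{1}u_eq0 tu scale1r.
  have /eqP := u_eq0; rewrite psumr_eq0// => /allP/(_ i).
  by rewrite mem_index_enum => /(_ isT)/eqP ->; rewrite scale0r.
pose y i := x (lift ord0 i) / u.
have Ky : K (\sum_i y i *: w (lift ord0 i)).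
  apply: IH => // [i|]; first by rewrite divr_ge0.
  by rewrite -mulr_suml divff.
have := Kconv (w ord0) _ (Itv01 (proj1 (andP t01)) (proj2 (andP t01))) _ (mem_set Ky).
move=> /(_ (mem_set (Kw ord0)))/set_mem; congr K.
rewrite /conv/=; congr (_ + _).
rewrite scaler_sumr; apply: eq_bigr => i _.
rewrite scalerA /y; congr (_ *: _).
have tu1 : 1 - t = u by rewrite -tu addrC addKr.
by rewrite /unstable.onem/= tu1 mulrC divfK.
Qed.

(** By polarization the inner product is a combination of squared norms. *)
Lemma continuous_inner (R : realType) (H : hilbertType R) (T : topologicalType)
    (f g : T -> H) : continuous f -> continuous g ->
  continuous (fun z => inner (f z) (g z) : R).
Proof.
move=> cf cg; have polar (u v : H) :
    inner u v = (`|u + v| ^+ 2 - `|u| ^+ 2 - `|v| ^+ 2) / 2 :> R.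
  have innerC : inner v u = inner u v :> R by rewrite hermC/= expr0 mul1r.
  have innerDl w : inner (u + v) w = inner u w + inner v w :> R by exact: linearDl.
  have innerDr w : inner w (u + v) = inner w u + inner w v :> R by exact: linearDr.
  rewrite !sqr_normrE innerDl !innerDr innerC.
  by field.
under [X in continuous X]funext do rewrite polar.
move=> z; have csqr (h : T -> H) : h @ z --> h z ->
    (fun z => `|h z| ^+ 2) @ z --> `|h z| ^+ 2.
  by move=> ch; rewrite expr2; under eq_fun do rewrite expr2; apply: cvgM; exact: cvg_norm.
apply: cvgM; last exact: cvg_cst.
apply: cvgB; last exact/csqr/cg.
apply: cvgB; last exact/csqr/cf.
by apply: csqr; apply: cvgD; [exact: cf|exact: cg].
Qed.

(** For finitely many [w] and up to a positive error, the inequality is the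
    approximate equilibrium of the matrix [b (w i) (w j)].  The solution sets
    for one [w] and one error are closed in the compact set [K] and have the
    finite intersection property. *)
Lemma bilinear_ky_fan (R : realType) (V : normedModType R) (K : set V)
    (b : V -> V -> R) :
  (forall z, scalar (b^~ z)) -> (forall w, scalar (b w)) ->
  (forall w, continuous (b w)) -> continuous (fun z => b z z) ->
  compact K -> convex_set K -> K !=set0 ->
  exists2 z, K z & forall w, K w -> b w z <= b z z.
Proof.
move=> bl br cb cbb Kcompact Kconv [w0 Kw0].
have lin_sum (h : V -> R) : scalar h -> forall n (x : 'I_n -> R) (w : 'I_n -> V),
    h (\sum_i x i *: w i) = \sum_i x i * h (w i).
  move=> hl n x w; pose hL := GRing.isLinear.Build _ _ _ _ h hl.
  pose hh : {scalar V} := HB.pack h hL.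
  rewrite -[h]/(hh : V -> R) linear_sum; apply: eq_bigr => i _.
  by rewrite linearZ.
have approx n (w : 'I_n.+2 -> V) eps : (forall i, K (w i)) -> 0 < eps ->
    exists2 z, K z & forall i, b (w i) z <= b z z + eps.
  move=> Kw eps0; have [|x [x0 x1 xP]] :=
    @approx_symmetric_equilibrium R 'I_n.+2 (fun i j => b (w i) (w j)) eps _ eps0.
    by rewrite card_ord.
  pose z := \sum_i x i *: w i.
  exists z => [|i]; first exact: convex_set_sum.
  have bw j : b (w j) z = \sum_k b (w j) (w k) * x k.
    by rewrite lin_sum//; apply: eq_bigr => k _; rewrite mulrC.
  have -> : b z z = \sum_i x i * \sum_k b (w i) (w k) * x k.
    rewrite [LHS](lin_sum (b^~ z))//.
    by apply: eq_bigr => j _; rewrite bw.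
  by rewrite bw.
pose F (i : V * nat) := [set z | b i.1 z - b z z <= i.2.+1%:R^-1].
have : \bigcap_(i in [set i | K i.1]) (K `&` F i) !=set0.
  have := Kcompact; rewrite compact_In0; apply.
    exists F => // i _.
    apply: (@closed_comp _ _ (fun z => b i.1 z - b z z) [set r | r <= i.2.+1%:R^-1]).
      by move=> z _; apply: cvgB; [exact: cb|exact: cbb].
    exact: closed_le.
  move=> D DK; pose s : seq (V * nat) := enum_fset D.
  pose k := \max_(i <- s) i.2.
  (* The index type has two spare elements, sent to [w0] by the default value of
     [nth], since at least two points are needed. *)
  pose w (i : 'I_(size s).+2) := nth w0 (map fst s) i.
  have [i|//|z Kz zP] := @approx _ w (k.+1%:R^-1) _ _.
    rewrite /w; have [si|si] := ltnP i (size s); last by rewrite nth_default// size_map.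
    rewrite (nth_map (w0, 0%N))//.
    by have := DK (nth (w0, 0%N) s i) (mem_nth _ si); rewrite inE.
  exists z => -[v l]/= vD; split=> //=.
  have vs : (v, l) \in s by [].
  have idx : (index (v, l) s < (size s).+2)%N by rewrite ltnS ltnW// ltnS ltnW// index_mem.
  have := zP (Ordinal idx); rewrite /w/= (nth_map (w0, 0%N)) ?index_mem// nth_index//=.
  rewrite /F/= lerBlDl => /le_trans; apply; rewrite lerD2l lef_pV2 ?posrE// ler_nat ltnS.
  exact: (@leq_bigmax_seq _ _ xpredT snd (v, l)).
move=> [z zP]; exists z => [|w Kw]; first by have [] := zP (w0, 0%N) Kw0.
rewrite leNgt; apply/negP => /ltr_add_invr[k].
by rewrite ltNge -lerBlDl; have [_ /= ->] := zP (w, k) Kw.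
Qed.

(** * Nash equilibria *)

Theorem theorem3p4 (R : realType) (H1 H2 : hilbertType R)
    (Omega1 : set H1) (Omega2 : set H2)
    (Omega1_neq0 : Omega1 !=set0) (Omega2_neq0 : Omega2 !=set0)
    (Omega1_compact : compact Omega1) (Omega2_compact : compact Omega2)
    (Omega1_convex : convex_set Omega1) (Omega2_convex : convex_set Omega2)
    (A : {linear H2 -> H1}) (B : {linear H1 -> H2})
    (A_continuous : continuous A) (B_continuous : continuous B) :
  let u1 (p : Omega1) (q : Omega2) : R := inner (val p) (A (val q)) in
  let u2 (p : Omega1) (q : Omega2) : R := inner (val q) (B (val p)) in
  exists (pbar : Omega1) (qbar : Omega2),
    nash_equilibrium (TwoPersonGame Omega1_neq0 Omega2_neq0 u1 u2)
      pbar qbar.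
Proof.
move=> u1 u2.
pose b (w z : H1 * H2) : R := inner w.1 (A z.2) + inner w.2 (B z.1).
have c1 : continuous (fun z : H1 * H2 => z.1) by move=> z; exact: cvg_fst.
have c2 : continuous (fun z : H1 * H2 => z.2) by move=> z; exact: cvg_snd.
have cA : continuous (fun z : H1 * H2 => A z.2).
  by move=> z; apply: continuous_comp; [exact: c2|exact: A_continuous].
have cB : continuous (fun z : H1 * H2 => B z.1).
  by move=> z; apply: continuous_comp; [exact: c1|exact: B_continuous].
have [|||||||[p q] [/= Op Oq] pqP] := @bilinear_ky_fan R (H1 * H2)%type
  (Omega1 `*` Omega2) b.
- move=> z a u v; rewrite /b /= !linearDl !linearZl_LR/=.
  by rewrite mulrDr addrACA.
- move=> w a u v; rewrite /b /= !linearP/=.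
  by rewrite mulrDr addrACA.
- move=> w z; apply: cvgD.
    exact: (@continuous_inner _ _ _ (fun=> w.1) _ (@cst_continuous _ _ _) cA).
  exact: (@continuous_inner _ _ _ (fun=> w.2) _ (@cst_continuous _ _ _) cB).
- move=> z; apply: cvgD; [exact: (continuous_inner c1 cA)|].
  exact: (continuous_inner c2 cB).
- exact: compact_setX.
- move=> u v t /set_mem[u1' u2'] /set_mem[v1 v2]; apply/mem_set; split.
    exact/set_mem/(Omega1_convex _ _ t (mem_set u1') (mem_set v1)).
  exact/set_mem/(Omega2_convex _ _ t (mem_set u2') (mem_set v2)).
- have [p0 p0P] := Omega1_neq0; have [q0 q0P] := Omega2_neq0.
  by exists (p0, q0).
exists (SigSub (mem_set Op)), (SigSub (mem_set Oq)); split=> /=.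
  move=> p'; have := pqP (val p', q) (conj (set_mem (valP p')) Oq).
  by rewrite /b/= lerD2r.
move=> q'; have := pqP (p, val q') (conj Op (set_mem (valP q'))).
by rewrite /b/= lerD2l.
Qed.
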